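(* Consider the control-affine system $\dot x=f(x)+g(x)u$, $x\in\mathbb{R}^n$, $u\in\mathbb{R}^m$, of the partitioned form described in the context, a set $\mathcal{C}$ with an associated reciprocal control barrier function $B:\mathrm{Int}(\mathcal{C})\to\mathbb{R}$, and an exponentially stabilizing control Lyapunov function $V$. Let $c_3>0$ be a constant, let $\alpha$ be a class $\mathcal{K}$ function, and for each $x$ let $H(x)\in\mathbb{R}^{(m+1)\times(m+1)}$ be positive definite and $F(x)\in\mathbb{R}^{m+1}$. Consider the quadratic program $$\mathbf{u}^*(x)=\underset{\mathbf{u}=(u,\delta)\in\mathbb{R}^m\times\mathbb{R}}{\operatorname{argmin}}\ \tfrac12\mathbf{u}^\top H(x)\mathbf{u}+F(x)^\top\mathbf{u}$$ subject to $$L_fV(x)+L_gV(x)u+c_3V(x)-\delta\le 0,\qquad L_fB(x)+L_gB(x)u-\alpha(h(x))\le 0.$$ Suppose that the following functions are all locally Lipschitz: the vector fields $f$ and $g$, the gradients of $B$ and $V$, and the cost function terms $H(x)$ and $F(x)$. Suppose furthermore that the relative degree one condition, $L_gB(x)\neq 0$ for all $x\in\mathrm{Int}(\mathcal{C})$, holds. Then the solution $\mathbf{u}^*(x)$ of the quadratic program is locally Lipschitz continuous for $x\in\mathrm{Int}(\mathcal{C})$. Moreover, a closed-form expression can be given for $\mathbf{u}^*(x)$.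
   Context: System: $x=(x_1,x_2)$ with $x_1\in X\subset\mathbb{R}^{n_1}$, $x_2\in Z\subset\mathbb{R}^{n_2}$, $n_1+n_2=n$, $f(x)=(f_1(x_1,x_2),f_2(x_1,x_2))$, $g(x)=(g_1(x_1,x_2),0)$, and $f_1(0,x_2)=0$. $U\subset\mathbb{R}^m$ denotes the set of admissible control values. For a continuously differentiable $W$, $L_fW(x)=\frac{\partial W}{\partial x}(x)f(x)\in\mathbb{R}$ and $L_gW(x)=\frac{\partial W}{\partial x}(x)g(x)$ (a row vector in $\mathbb{R}^{1\times m}$). Set: $h:\mathbb{R}^n\to\mathbb{R}$ is continuously differentiable, $\mathcal{C}=\{x: h(x)\ge0\}$, $\partial\mathcal{C}=\{x:h(x)=0\}$, $\mathrm{Int}(\mathcal{C})=\{x:h(x)>0\}$. Class $\mathcal{K}$: continuous strictly increasing functions $\beta:[0,a)\to[0,\infty)$, for some $a>0$, with $\beta(0)=0$. Reciprocal control barrier function (RCBF): a continuously differentiable $B:\mathrm{Int}(\mathcal{C})\to\mathbb{R}$ for which there are class $\mathcal{K}$ functions $\alpha_1,\alpha_2,\alpha_3$ such that for all $x\in\mathrm{Int}(\mathcal{C})$, $\frac1{\alpha_1(h(x))}\le B(x)\le\frac1{\alpha_2(h(x))}$ and $\inf_{u\in U}[L_fB(x)+L_gB(x)u-\alpha_3(h(x))]\le0$. Exponentially stabilizing control Lyapunov function (ES-CLF): a continuously differentiable $V:X\times Z\to\mathbb{R}$ for which there are constants $c_1,c_2,c_3>0$ with $c_1\|x_1\|^2\le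 V(x)\le c_2\|x_1\|^2$ and $\inf_{u\in U}[L_fV(x)+L_gV(x)u+c_3V(x)]\le0$ for all $x=(x_1,x_2)\in X\times Z$.
   Formalization: The class K function α of the quadratic program is additionally assumed locally Lipschitz on (0,a), without which the claim is false (e.g. α(r)=1+∛(r−1)); the conclusion is stated on the part of Int(C) lying in X×Z, where V is defined. *)

(* Defs.v *)
From mathcomp Require Import all_boot all_order all_algebra.
From mathcomp Require Import all_classical all_reals all_analysis.

Set Implicit Arguments.
Unset Strict Implicit.
Unset Printing Implicit Defensive.

Import Order.TTheory GRing.Theory Num.Theory.
Import numFieldNormedType.Exports.

Local Open Scope classical_set_scope.
Local Open Scope ring_scope.

(* Vectors of R^n are columns, gradients are rows.  The library norm on
   matrices is the max norm: it is used for Lipschitz continuity only, where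
   all norms are equivalent; bounds that involve the norm of a vector use
   [enorm]. *)

Definition enorm (R : realType) (n : nat) (x : 'cV[R]_n) : R :=
  Num.sqrt (\sum_i x i 0 ^+ 2).

Definition gradient (R : realType) (n : nat) (W : 'cV[R]_n -> R)
    (x : 'cV[R]_n) : 'rV[R]_n :=
  \row_j 'D_(delta_mx j 0) W x.

(* Functions on a subset of R^n are represented by total functions.  [C1_on A]
   says that W is continuously differentiable on an open neighbourhood of A;
   when A is open this is continuous differentiability on A, and it depends
   only on the values of W on A. *)
Definition C1_on (R : realType) (n : nat) (A : set 'cV[R]_n)
    (W : 'cV[R]_n -> R) : Prop :=
  forall x, A x ->
    \forall y \near x, differentiable W y /\ {for y, continuous (gradient W)}.

Definition lieF (R : realType) (n : nat) (f : 'cV[R]_n -> 'cV[R]_n)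
    (W : 'cV[R]_n -> R) (x : 'cV[R]_n) : R :=
  (gradient W x *m f x) 0 0.

Definition lieG (R : realType) (n m : nat) (g : 'cV[R]_n -> 'M[R]_(n, m))
    (W : 'cV[R]_n -> R) (x : 'cV[R]_n) : 'rV[R]_m :=
  gradient W x *m g x.

(* The library notion quantifies over pairs (x, y) of points of A; its content
   is at the pairs (x, x), since for x != y it only asks for boundedness near
   x and y. *)
Definition locally_lipschitz (R : realType) (V W : normedModType R)
    (A : set V) (f : V -> W) : Prop :=
  [locally [lipschitz f x | x in A]].

(* The right end point a may be +oo. *)
Definition classK (R : realType) (a : \bar R) (b : R -> R) : Prop :=
  [/\ (0 < a)%E,
      {within [set r | 0 <= r /\ (r%:E < a)%E], continuous b},
      forall r, 0 <= r -> (r%:E < a)%E -> 0 <= b r,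
      forall r s, 0 <= r -> r < s -> (s%:E < a)%E -> b r < b s
    & b 0 = 0].

Definition intC (R : realType) (n : nat) (h : 'cV[R]_n -> R) : set 'cV[R]_n :=
  [set x | 0 < h x].

Definition state_space (R : realType) (n1 n2 : nat) (X : set 'cV[R]_n1)
    (Z : set 'cV[R]_n2) : set 'cV[R]_(n1 + n2) :=
  [set x | X (usubmx x) /\ Z (dsubmx x)].

Definition partitioned_system (R : realType) (n1 n2 m : nat)
    (X : set 'cV[R]_n1) (Z : set 'cV[R]_n2)
    (f : 'cV[R]_(n1 + n2) -> 'cV[R]_(n1 + n2))
    (g : 'cV[R]_(n1 + n2) -> 'M[R]_(n1 + n2, m)) : Prop :=
  (forall x, state_space X Z x -> usubmx x = 0 -> usubmx (f x) = 0) /\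
  (forall x, state_space X Z x -> dsubmx (g x) = 0).

(* The infimum is taken in the extended reals: it may be -oo, and it is +oo
   when U is empty.  The conditions h x < a_i make alpha_i (h x) meaningful. *)
Definition is_RCBF (R : realType) (n m : nat) (U : set 'cV[R]_m)
    (f : 'cV[R]_n -> 'cV[R]_n) (g : 'cV[R]_n -> 'M[R]_(n, m))
    (h B : 'cV[R]_n -> R) : Prop :=
  C1_on (intC h) B /\
  exists (a1 a2 a3 : \bar R) (alpha1 alpha2 alpha3 : R -> R),
    [/\ classK a1 alpha1, classK a2 alpha2, classK a3 alpha3
      & forall x, intC h x ->
        [/\ [/\ ((h x)%:E < a1)%E, ((h x)%:E < a2)%E & ((h x)%:E < a3)%E],
            (alpha1 (h x))^-1 <= B x,
            B x <= (alpha2 (h x))^-1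
          & (ereal_inf [set (lieF f B x + (lieG g B x *m u) 0 0
                             - alpha3 (h x))%:E | u in U] <= 0)%E]].

Definition is_ESCLF (R : realType) (n1 n2 m : nat) (U : set 'cV[R]_m)
    (X : set 'cV[R]_n1) (Z : set 'cV[R]_n2)
    (f : 'cV[R]_(n1 + n2) -> 'cV[R]_(n1 + n2))
    (g : 'cV[R]_(n1 + n2) -> 'M[R]_(n1 + n2, m))
    (V : 'cV[R]_(n1 + n2) -> R) : Prop :=
  C1_on (state_space X Z) V /\
  exists c1 c2 c3 : R,
    [/\ 0 < c1, 0 < c2, 0 < c3
      & forall x, state_space X Z x ->
        [/\ c1 * enorm (usubmx x) ^+ 2 <= V x,
            V x <= c2 * enorm (usubmx x) ^+ 2
          & (ereal_inf [set (lieF f V x + (lieG g V x *m u) 0 0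
                             + c3 * V x)%:E | u in U] <= 0)%E]].

Definition posdefmx (R : realType) (k : nat) (H : 'M[R]_k) : Prop :=
  H^T = H /\ forall v : 'cV[R]_k, v != 0 -> 0 < (v^T *m H *m v) 0 0.

Definition qp_cost (R : realType) (k : nat) (H : 'M[R]_k) (F : 'cV[R]_k)
    (v : 'cV[R]_k) : R :=
  2^-1 * (v^T *m H *m v) 0 0 + (F^T *m v) 0 0.

Definition is_argmin (R : realType) (T : Type) (D : set T) (J : T -> R)
    (v : T) : Prop :=
  D v /\ forall w, D w -> J v <= J w.

(* The decision variable is v = (u, delta), with u = usubmx v. *)
Definition clf_cbf_feasible (R : realType) (n m : nat)
    (f : 'cV[R]_n -> 'cV[R]_n) (g : 'cV[R]_n -> 'M[R]_(n, m))
    (h B V : 'cV[R]_n -> R) (c3 : R) (alpha : R -> R) (x : 'cV[R]_n) :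
    set 'cV[R]_(m + 1) :=
  [set v | lieF f V x + (lieG g V x *m usubmx v) 0 0 + c3 * V x
             - dsubmx v 0 0 <= 0 /\
           lieF f B x + (lieG g B x *m usubmx v) 0 0 - alpha (h x) <= 0].

(* Closed form of the minimizer of [qp_cost H F] under y1 v <= p1, y2 v <= p2,
   obtained from the KKT conditions in the inner product given by H.  Here
   ubar is the unconstrained minimizer, q_i the amount by which it violates
   the i-th constraint, G the Gram matrix of y1, y2, and l the pair of
   Lagrange multipliers.  The three cases are: second multiplier zero, first
   multiplier zero, both constraints active. *)
Definition qp2_solution (R : realType) (k : nat) (H : 'M[R]_k) (F : 'cV[R]_k)
    (y1 : 'rV[R]_k) (p1 : R) (y2 : 'rV[R]_k) (p2 : R) : 'cV[R]_k :=
  let ubar := - (invmx H *m F) in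
  let q1 := (y1 *m ubar) 0 0 - p1 in
  let q2 := (y2 *m ubar) 0 0 - p2 in
  let G11 := (y1 *m invmx H *m y1^T) 0 0 in
  let G12 := (y1 *m invmx H *m y2^T) 0 0 in
  let G22 := (y2 *m invmx H *m y2^T) 0 0 in
  let l :=
    if G11 * q2 <= G12 * Num.max 0 q1 then (Num.max 0 q1 / G11, 0)
    else if G22 * q1 <= G12 * Num.max 0 q2 then (0, Num.max 0 q2 / G22)
    else ((G22 * q1 - G12 * q2) / (G11 * G22 - G12 ^+ 2),
          (G11 * q2 - G12 * q1) / (G11 * G22 - G12 ^+ 2)) in
  ubar - invmx H *m (l.1 *: y1^T + l.2 *: y2^T).

Definition clf_cbf_solution (R : realType) (n m : nat)
    (f : 'cV[R]_n -> 'cV[R]_n) (g : 'cV[R]_n -> 'M[R]_(n, m))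
    (h B V : 'cV[R]_n -> R) (c3 : R) (alpha : R -> R)
    (H : 'cV[R]_n -> 'M[R]_(m + 1)) (F : 'cV[R]_n -> 'cV[R]_(m + 1))
    (x : 'cV[R]_n) : 'cV[R]_(m + 1) :=
  qp2_solution (H x) (F x)
    (row_mx (lieG g V x) (- 1%:M)) (- lieF f V x - c3 * V x)
    (row_mx (lieG g B x) 0) (alpha (h x) - lieF f B x).

(* Main.v *)
(* The KKT multipliers l of the quadratic program solve the linear
   complementarity problem l >= 0, G l - q >= 0, l . (G l - q) = 0, where G is
   the Gram matrix of the two constraint rows in the inner product given by the
   inverse of H, and q is the constraint violation at the unconstrained
   minimizer.  The rows (L_g V, -1) and (L_g B, 0) are linearly independent
   because L_g B <> 0, so G is positive definite.  A positive definite
   complementarity problem is strongly monotone, so its solution is a Lipschitz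
   function of the data (G, q), uniformly where det G stays away from 0; the case
   distinction in the closed form therefore never has to be analysed near its
   boundaries.  The data are locally Lipschitz functions of x: V and h are by the
   mean value theorem. *)

Require Import Defs.
From mathcomp Require Import all_boot all_order all_algebra.
From mathcomp Require Import all_classical all_reals all_analysis.
From mathcomp Require Import ring lra.
Set Implicit Arguments.
Unset Strict Implicit.
Unset Printing Implicit Defensive.
Import Order.TTheory GRing.Theory Num.Theory.
Import numFieldNormedType.Exports.
Local Open Scope classical_set_scope.
Local Open Scope ring_scope.

(** * Linear complementarity problems with two unknowns *)

Definition gram (R : realType) (k : nat) (H : 'M[R]_k) (y z : 'rV[R]_k) : R :=
  (y *m invmx H *m z^T) 0 0.

Definition lcp2 (R : realType) (G11 G12 G22 q1 q2 l1 l2 : R) : Prop :=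
  [/\ 0 <= l1, 0 <= l2,
      q1 <= G11 * l1 + G12 * l2, q2 <= G12 * l1 + G22 * l2
    & l1 * (G11 * l1 + G12 * l2 - q1) = 0 /\
      l2 * (G12 * l1 + G22 * l2 - q2) = 0].

(** Repeats the multipliers inside [qp2_solution] literally, so that the two agree by unfolding. *)
Definition lcp2_solution (R : realType) (G11 G12 G22 q1 q2 : R) : R * R :=
  if G11 * q2 <= G12 * Num.max 0 q1 then (Num.max 0 q1 / G11, 0)
  else if G22 * q1 <= G12 * Num.max 0 q2 then (0, Num.max 0 q2 / G22)
  else ((G22 * q1 - G12 * q2) / (G11 * G22 - G12 ^+ 2),
        (G11 * q2 - G12 * q1) / (G11 * G22 - G12 ^+ 2)).

(** Sign of a multiplier in the last case of [lcp2_solution]; exchanging the two indices gives the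
    other multiplier. The hypotheses are the failed tests of the first two cases. *)
Lemma lcp2_both_ge0 (R : realType) (G11 G12 G22 q1 q2 : R) :
  0 < G22 -> 0 < G11 * G22 - G12 ^+ 2 ->
  G12 * Num.max 0 q1 < G11 * q2 -> G12 * Num.max 0 q2 < G22 * q1 ->
  0 <= G11 * q2 - G12 * q1.
Proof.
move=> G22_gt0 det_gt0 lt1 lt2.
have [G12_ge0|G12_lt0] := leP 0 G12.
  rewrite subr_ge0; apply: le_trans (ltW lt1).
  by rewrite ler_wpM2l// le_max lexx orbT.
have [q1_ge0|q1_lt0] := leP 0 q1.
  by move: lt1; rewrite (max_r q1_ge0); lra.
(* With [q1 < 0], a nonpositive [q2] would make the second hypothesis read [0 < G22 * q1], which is
   absurd. *)
have [q2_le0|q2_gt0] := leP q2 0.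
  move: lt2; rewrite (max_l q2_le0) mulr0 pmulr_rgt0//; lra.
move: lt2; rewrite (max_r (ltW q2_gt0)) => lt2.
(* Multiply the claim by [G22]: since [- G12 > 0], the second hypothesis bounds the product below by
   the determinant times [q2]. *)
rewrite -(pmulr_rge0 _ G22_gt0); nra.
Qed.

Lemma lcp2_solutionP (R : realType) (G11 G12 G22 q1 q2 : R) :
  0 < G11 -> 0 < G22 -> 0 < G11 * G22 - G12 ^+ 2 ->
  let l := lcp2_solution G11 G12 G22 q1 q2 in
  lcp2 G11 G12 G22 q1 q2 l.1 l.2.
Proof.
move=> G11_gt0 G22_gt0 det_gt0; rewrite /= /lcp2_solution.
have max0M (q : R) : Num.max 0 q * (Num.max 0 q - q) = 0.
  by have [|] := leP 0 q; rewrite ?subrr ?mulr0 ?mul0r.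
have ge_max (q : R) : 0 <= Num.max 0 q /\ q <= Num.max 0 q.
  by rewrite !le_max !lexx orbT.
(* When the second multiplier is 0, the first must be [Num.max 0 q1 / G11], and the test is exactly
   the remaining inequality on [q2]. The second case is symmetric. *)
have [le1|lt1] := leP (G11 * q2) (G12 * Num.max 0 q1).
  have [m_ge0 m_ge] := ge_max q1; have mM := max0M q1.
  rewrite /lcp2 /=; set m := Num.max 0 q1 in le1 m_ge0 m_ge mM *.
  have GE : G11 * (m / G11) = m by rewrite mulrCA divff ?mulr1// gt_eqF.
  split; rewrite ?divr_ge0 ?(ltW G11_gt0)// ?mulr0 ?addr0 ?mul0r ?GE//.
  - by rewrite mulrA ler_pdivlMr// mulrC.
  - by split=> //; rewrite mulrAC mM mul0r.
have [le2|lt2] := leP (G22 * q1) (G12 * Num.max 0 q2).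
  have [m_ge0 m_ge] := ge_max q2; have mM := max0M q2.
  rewrite /lcp2 /=; set m := Num.max 0 q2 in le2 m_ge0 m_ge mM *.
  have GE : G22 * (m / G22) = m by rewrite mulrCA divff ?mulr1// gt_eqF.
  split; rewrite ?divr_ge0 ?(ltW G22_gt0)// ?mulr0 ?add0r ?mul0r ?GE//.
  - by rewrite mulrA ler_pdivlMr// mulrC.
  - by split=> //; rewrite mulrAC mM mul0r.
(* Both slacks vanish here: the multipliers are Cramer's solution of [G l = q], and only their signs
   are left. *)
rewrite /lcp2 /=; set D := _ - G12 ^+ 2 in det_gt0 *.
have D_neq0 : D != 0 by rewrite gt_eqF.
have E1 : G11 * ((G22 * q1 - G12 * q2) / D) + G12 * ((G11 * q2 - G12 * q1) / D)
          = q1 by rewrite /D in D_neq0 *; field.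
have E2 : G12 * ((G22 * q1 - G12 * q2) / D) + G22 * ((G11 * q2 - G12 * q1) / D)
          = q2 by rewrite /D in D_neq0 *; field.
split; rewrite ?E1 ?E2 ?subrr ?mulr0// divr_ge0 ?(ltW det_gt0)//.
  by apply: lcp2_both_ge0 G11_gt0 _ lt2 lt1; rewrite (mulrC G22).
exact: lcp2_both_ge0 G22_gt0 _ lt1 lt2.
Qed.

(* Cayley-Hamilton: tr(G) x^T G x - det(G) |x|^2 = |G x|^2. *)
Lemma gram2_coercive (R : realType) (G11 G12 G22 x1 x2 : R) :
  (G11 * G22 - G12 ^+ 2) * (x1 ^+ 2 + x2 ^+ 2) <=
  (G11 + G22) * (x1 * (G11 * x1 + G12 * x2) + x2 * (G12 * x1 + G22 * x2)).
Proof.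
rewrite -subr_ge0.
rewrite (_ : _ - _ = (G11 * x1 + G12 * x2) ^+ 2 + (G12 * x1 + G22 * x2) ^+ 2).
  by rewrite addr_ge0 ?sqr_ge0.
by ring.
Qed.

(* Complementarity and nonnegativity give (l - l') . (w - w') <= 0 for the slacks
   w = G l - q and w' = G' l' - q'; strong monotonicity of G does the rest. *)
Lemma lcp2_stable (R : realType) (G11 G12 G22 q1 q2 l1 l2 : R)
    (G11' G12' G22' q1' q2' l1' l2' E : R) :
  0 < G11 + G22 -> 0 < G11 * G22 - G12 ^+ 2 ->
  lcp2 G11 G12 G22 q1 q2 l1 l2 -> lcp2 G11' G12' G22' q1' q2' l1' l2' ->
  `|(q1 - q1') - ((G11 - G11') * l1' + (G12 - G12') * l2')| <= E ->
  `|(q2 - q2') - ((G12 - G12') * l1' + (G22 - G22') * l2')| <= E ->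
  (G11 * G22 - G12 ^+ 2) * (`|l1 - l1'| + `|l2 - l2'|) <=
  2 * (G11 + G22) * E.
Proof.
move=> tr_gt0 det_gt0 [l1_ge0 l2_ge0 w1 w2 [c1 c2]].
move=> [l1'_ge0 l2'_ge0 w1' w2' [c1' c2']].
(* In vector form [e = G (l - l') - (w - w')]: it is the change of the data, with the change of [G]
   evaluated at [l']. *)
set e1 := (q1 - q1') - _; set e2 := (q2 - q2') - _ => e1E e2E.
have E0 : 0 <= E by exact: le_trans e1E.
have mono : (l1 - l1') * (G11 * (l1 - l1') + G12 * (l2 - l2')) +
            (l2 - l2') * (G12 * (l1 - l1') + G22 * (l2 - l2')) <=
            (l1 - l1') * e1 + (l2 - l2') * e2.
  rewrite -subr_ge0 [leRHS](_ : _ =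
    l1 * (G11' * l1' + G12' * l2' - q1') - l1 * (G11 * l1 + G12 * l2 - q1) +
    (l1' * (G11 * l1 + G12 * l2 - q1) - l1' * (G11' * l1' + G12' * l2' - q1')) +
    (l2 * (G12' * l1' + G22' * l2' - q2') - l2 * (G12 * l1 + G22 * l2 - q2) +
    (l2' * (G12 * l1 + G22 * l2 - q2) - l2' * (G12' * l1' + G22' * l2' - q2')))).
    by rewrite c1 c2 c1' c2' !subr0 !addr_ge0 ?mulr_ge0 ?subr_ge0.
  by rewrite /e1 /e2; ring.
have := gram2_coercive G11 G12 G22 (l1 - l1') (l2 - l2').
set x1 := l1 - l1' in mono *; set x2 := l2 - l2' in mono *.
set D := G11 * G22 - _ in det_gt0 *; set t := G11 + G22 in tr_gt0 *.
move=> coer; clearbody x1 x2 D t e1 e2; set s := `|x1| + `|x2|.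
have s_ge0 : 0 <= s by rewrite addr_ge0.
have xe : x1 * e1 + x2 * e2 <= s * E.
  rewrite /s mulrDl; apply: lerD.
    by rewrite (le_trans (ler_norm _))// normrM ler_wpM2l.
  by rewrite (le_trans (ler_norm _))// normrM ler_wpM2l.
have s2 : s ^+ 2 <= 2 * (x1 ^+ 2 + x2 ^+ 2).
  rewrite -(real_normK (num_real x1)) -(real_normK (num_real x2)) /s.
  have := sqr_ge0 (`|x1| - `|x2|); nra.
have h1 : D * s ^+ 2 <= 2 * t * (s * E).
  apply: le_trans (_ : D * (2 * (x1 ^+ 2 + x2 ^+ 2)) <= _).
    by rewrite ler_wpM2l// ltW.
  rewrite mulrCA -mulrA ler_wpM2l//; apply: le_trans coer _.
  by rewrite ler_wpM2l ?(ltW tr_gt0)// (le_trans mono).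
have [->|s_neq0] := eqVneq s 0.
  by rewrite mulr0 !mulr_ge0// ltW.
have s_gt0 : 0 < s by rewrite lt_neqAle eq_sym s_neq0.
rewrite -(ler_pM2r s_gt0); move: h1; rewrite expr2.
by rewrite !mulrA (mulrAC _ s E).
Qed.

(** Stability against the problem with the same matrix and [q = 0], which is solved by [l = 0]. *)
Lemma lcp2_bound (R : realType) (G11 G12 G22 q1 q2 l1 l2 E : R) :
  0 < G11 + G22 -> 0 < G11 * G22 - G12 ^+ 2 ->
  lcp2 G11 G12 G22 q1 q2 l1 l2 -> `|q1| <= E -> `|q2| <= E ->
  (G11 * G22 - G12 ^+ 2) * (`|l1| + `|l2|) <= 2 * (G11 + G22) * E.
Proof.
move=> tr_gt0 det_gt0 l_lcp q1E q2E.
have lcp0 : lcp2 G11 G12 G22 0 0 0 0.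
  by split; rewrite ?mulr0 ?addr0 ?subr0 ?mulr0.
have := lcp2_stable tr_gt0 det_gt0 l_lcp lcp0.
by rewrite !mulr0 !addr0 !subr0; apply.
Qed.

(** * Positive definite matrices and Gram determinants *)

Lemma posdefmx_unit (R : realType) (k : nat) (H : 'M[R]_k) :
  posdefmx H -> H \in unitmx.
Proof.
move=> [_ Hpos]; rewrite -row_free_unit -kermx_eq0; apply/eqP/row_matrixP => i.
rewrite row0; apply/eqP; apply: contraT => v_neq0; set v := row i _ in v_neq0.
have vH : v *m H = 0 by apply/sub_kermxP; rewrite row_sub.
have := Hpos v^T; rewrite trmx_eq0 => /(_ v_neq0).
by rewrite trmxK vH mul0mx mxE ltxx.
Qed.

Lemma invmx_posdef (R : realType) (k : nat) (H : 'M[R]_k) :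
  posdefmx H -> posdefmx (invmx H).
Proof.
move=> Hpd; have Hu := posdefmx_unit Hpd; have [Hsym Hpos] := Hpd.
have sym : (invmx H)^T = invmx H by rewrite trmx_inv Hsym.
split=> // v v_neq0; have := Hpos (invmx H *m v).
rewrite trmx_mul sym -!mulmxA mulKVmx//; apply.
by apply: contra_neq v_neq0 => /(congr1 (mulmx H)); rewrite mulKVmx// mulmx0.
Qed.

Lemma gramC (R : realType) (k : nat) (H : 'M[R]_k) (y z : 'rV[R]_k) :
  posdefmx H -> gram H y z = gram H z y.
Proof.
move=> /invmx_posdef[sym _]; rewrite /gram.
have -> : y *m invmx H *m z^T = (z *m invmx H *m y^T)^T.
  by rewrite !trmx_mul trmxK sym mulmxA.
by rewrite mxE.
Qed.

Lemma gram_gt0 (R : realType) (k : nat) (H : 'M[R]_k) (y : 'rV[R]_k) :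
  posdefmx H -> y != 0 -> 0 < gram H y y.
Proof.
move=> /invmx_posdef[_ pos] y_neq0.
by have := pos y^T; rewrite trmx_eq0 trmxK; apply.
Qed.

(** The nonzero vector is [gram H z z] times the component of [y] orthogonal to [z], and its squared
    length is [gram H z z] times the Gram determinant. *)
Lemma gram_det_gt0 (R : realType) (k : nat) (H : 'M[R]_k) (y z : 'rV[R]_k) :
  posdefmx H -> z != 0 -> gram H z z *: y - gram H y z *: z != 0 ->
  0 < gram H y y * gram H z z - gram H y z ^+ 2.
Proof.
move=> Hpd z_neq0 indep; have zz_gt0 := gram_gt0 Hpd z_neq0.
have := gram_gt0 Hpd indep.
set a := gram H z z in zz_gt0 *; set b := gram H y z.
rewrite (_ : gram H _ _ = a * (gram H y y * a - b ^+ 2)) ?pmulr_rgt0//.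
have zy := gramC z y Hpd.
rewrite /gram (_ : (_ - _)^T = a *: y^T - b *: z^T); last first.
  by apply/matrixP => i j; rewrite !mxE.
rewrite mulmxBr !mulmxBl -!scalemxAr -!scalemxAl.
rewrite /a /b /gram in zy *; move: zy.
move: (y *m _ *m y^T) (y *m _ *m z^T) (z *m _ *m y^T) (z *m _ *m z^T).
by move=> yy yz zy zz; rewrite !mxE => ->; ring.
Qed.

(** * Optimality of the closed form *)

Lemma mulmx_row_col_tr (R : realType) (k : nat) (u v : 'cV[R]_k) :
  (u^T *m v) 0 0 = (v^T *m u) 0 0.
Proof. by rewrite -[u in RHS]trmxK -trmx_mul [RHS]mxE. Qed.

(** Exact Taylor expansion of the quadratic cost; [H *m v + F] is its gradient at [v]. *)
Lemma qp_cost_shift (R : realType) (k : nat) (H : 'M[R]_k) (F v d : 'cV[R]_k) :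
  H^T = H ->
  qp_cost H F (v + d) =
  qp_cost H F v + 2^-1 * (d^T *m H *m d) 0 0 + (d^T *m (H *m v + F)) 0 0.
Proof.
move=> sym.
have addE (A B : 'M[R]_1) : (A + B) 0 0 = A 0 0 + B 0 0 by rewrite mxE.
have vd : (v^T *m H *m d) 0 0 = (d^T *m H *m v) 0 0.
  by rewrite -{1}sym -trmx_mul mulmx_row_col_tr mulmxA.
have trD : (v + d)^T = v^T + d^T by apply/matrixP => i j; rewrite !mxE.
rewrite /qp_cost trD !mulmxDr !mulmxDl !addE vd.
rewrite (mulmx_row_col_tr d F) !mulmxA; by field.
Qed.

(** Sufficiency of the KKT conditions. The cost of a feasible point exceeds that of the KKT point by
    at least half the quadratic form of the displacement, which gives both minimality and
    uniqueness. *)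
Lemma qp2_solution_argmin (R : realType) (k : nat) (H : 'M[R]_k)
    (F : 'cV[R]_k) (y1 : 'rV[R]_k) (p1 : R) (y2 : 'rV[R]_k) (p2 : R) :
  posdefmx H -> y1 != 0 -> y2 != 0 ->
  0 < gram H y1 y1 * gram H y2 y2 - gram H y1 y2 ^+ 2 ->
  forall v, is_argmin [set w | (y1 *m w) 0 0 <= p1 /\ (y2 *m w) 0 0 <= p2]
              (qp_cost H F) v <-> v = qp2_solution H F y1 p1 y2 p2.
Proof.
move=> Hpd y1_neq0 y2_neq0 det_gt0.
have Hu := posdefmx_unit Hpd; have [Hsym Hpos] := Hpd.
pose ubar := - (invmx H *m F).
pose q1 := (y1 *m ubar) 0 0 - p1; pose q2 := (y2 *m ubar) 0 0 - p2.
pose l := lcp2_solution (gram H y1 y1) (gram H y1 y2) (gram H y2 y2) q1 q2.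
pose s := ubar - invmx H *m (l.1 *: y1^T + l.2 *: y2^T).
rewrite (_ : qp2_solution _ _ _ _ _ _ = s)//.
have : lcp2 (gram H y1 y1) (gram H y1 y2) (gram H y2 y2) q1 q2 l.1 l.2.
  exact: lcp2_solutionP (gram_gt0 Hpd y1_neq0) (gram_gt0 Hpd y2_neq0) det_gt0.
have ysE (y : 'rV[R]_k) : (y *m s) 0 0 =
    (y *m ubar) 0 0 - (gram H y y1 * l.1 + gram H y y2 * l.2).
  rewrite /s /gram mulmxBr mulmxA mulmxDr -!scalemxAr.
  move: (y *m ubar) (_ *m y1^T) (_ *m y2^T) => a b c.
  by rewrite !mxE; ring.
(* Stationarity of the Lagrangian. *)
have gradE : H *m s + F = - (l.1 *: y1^T + l.2 *: y2^T).
  by rewrite /s /ubar mulmxBr mulmxN !mulKVmx// addrAC addNr add0r.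
clearbody s l; case: l => l1 l2 /= in ysE gradE *.
move=> [l1_ge0 l2_ge0 w1 w2 [c1 c2]].
(* The slacks [p - y s] are those of the complementarity problem, whence primal feasibility and
   complementary slackness. *)
have s1 : (y1 *m s) 0 0 <= p1 by rewrite ysE; move: w1; rewrite /q1; lra.
have s2 : (y2 *m s) 0 0 <= p2.
  by rewrite ysE (gramC y2)//; move: w2; rewrite /q2; lra.
have l1E : l1 * ((y1 *m s) 0 0 - p1) = 0.
  by apply/eqP; rewrite ysE -oppr_eq0 -[X in _ == X]c1 /q1; apply/eqP; ring.
have l2E : l2 * ((y2 *m s) 0 0 - p2) = 0.
  apply/eqP; rewrite ysE (gramC y2)// -oppr_eq0 -[X in _ == X]c2 /q2.
  by apply/eqP; ring.
have costE (w : 'cV[R]_k) : (y1 *m w) 0 0 <= p1 -> (y2 *m w) 0 0 <= p2 ->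
    qp_cost H F s + 2^-1 * ((w - s)^T *m H *m (w - s)) 0 0 <= qp_cost H F w.
  move=> w1p w2p; rewrite -[w in leRHS](subrK s) addrC (addrC (w - s)).
  rewrite qp_cost_shift// gradE [leLHS]addrC lerDl mulmx_row_col_tr.
  set d := w - s.
  have -> : ((- (l1 *: y1^T + l2 *: y2^T))^T *m d) 0 0 =
            - (l1 * (y1 *m d) 0 0 + l2 * (y2 *m d) 0 0).
    rewrite (_ : _^T = - l1 *: y1 - l2 *: y2); last first.
      by apply/rowP => i; rewrite !mxE; ring.
    rewrite mulmxBl -!scalemxAl.
    by move: (y1 *m d) (y2 *m d) => a b; rewrite !mxE; ring.
  have yd (y : 'rV[R]_k) : (y *m d) 0 0 = (y *m w) 0 0 - (y *m s) 0 0.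
    by rewrite /d mulmxBr; move: (y *m w) (y *m s) => a b; rewrite !mxE.
  rewrite !yd.
  (* By [l1E] and [l2E], the linear term of the expansion is minus the sum of these two products. *)
  have : l1 * ((y1 *m w) 0 0 - p1) <= 0 by rewrite mulr_ge0_le0// subr_le0.
  have : l2 * ((y2 *m w) 0 0 - p2) <= 0 by rewrite mulr_ge0_le0// subr_le0.
  lra.
have quad_ge0 (d : 'cV[R]_k) : 0 <= 2^-1 * (d^T *m H *m d) 0 0.
  have [->|d_neq0] := eqVneq d 0; first by rewrite mulmx0 mxE mulr0.
  by rewrite mulr_ge0// ltW// Hpos.
move=> v; split=> [[[v1 v2] vmin]|->].
  apply/eqP; rewrite -subr_eq0; apply: contraT => d_neq0.
  have := costE v v1 v2; have := vmin s (conj s1 s2); have := Hpos _ d_neq0; lra.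
split=> // w [w1p w2p]; apply: le_trans (costE w w1p w2p).
by rewrite lerDl.
Qed.

(** * Functions bounded and Lipschitz near a point *)

(** The filter over which [locally_lipschitz] asks for a Lipschitz bound at the diagonal pair
    [(x, x)]. *)
Definition near2 (T : topologicalType) (A : set T) (x : T) : set_system (T * T) :=
  within (A `*` A) (nbhs (x, x)).

Instance near2_filter (T : topologicalType) (A : set T) (x : T) :
  Filter (near2 A x) := within_filter _ _.

Definition blip_pair (R : realType) (T W : normedModType R) (f : T -> W) (k : R)
    (p : T * T) : Prop :=
  [/\ `|f p.1| <= k, `|f p.2| <= k & `|f p.1 - f p.2| <= k * `|p.1 - p.2|].

(* Bounded and Lipschitz on A near x: the bound makes the class closed under
   products. *)
Definition blip (R : realType) (T W : normedModType R) (A : set T) (x : T)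
    (f : T -> W) : Prop :=
  exists2 k, 0 <= k & \forall p \near near2 A x, blip_pair f k p.

Lemma near2P (R : realType) (T : normedModType R) (A : set T) (x : T)
    (P : set (T * T)) :
  (\forall p \near near2 A x, P p) <->
  exists2 e, 0 < e & forall y z, A y -> A z ->
    `|x - y| < e -> `|x - z| < e -> P (y, z).
Proof.
split.
  move=> /nbhs_ballP[e /= e0 eP]; exists e => // y z Ay Az xy xz.
  by apply: (eP (y, z)); split => //=; rewrite -ball_normE.
move=> [e e0 eP]; apply/nbhs_ballP; exists e => //= -[y z] /= [].
rewrite -!ball_normE /= => xy xz [/= Ay Az]; exact: eP.
Qed.

Lemma near2S (T : topologicalType) (A A' : set T) (x : T) (P : set (T * T)) :
  A' `<=` A -> near2 A x P -> near2 A' x P.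
Proof.
by move=> A'A; apply: within_subset => -[y z] [/= /A'A Ay /A'A Az].
Qed.

Lemma blip_subset (R : realType) (T W : normedModType R) (A A' : set T) (x : T)
    (f : T -> W) : A' `<=` A -> blip A x f -> blip A' x f.
Proof. by move=> A'A [k k0 kf]; exists k => //; exact: near2S kf. Qed.

Lemma near2_in (T : topologicalType) (A : set T) (x : T) :
  \forall p \near near2 A x, A p.1 /\ A p.2.
Proof. exact: withinT. Qed.

Lemma blip_near (R : realType) (T W : normedModType R) (A : set T) (x : T)
    (f : T -> W) (k : R) : 0 <= k -> A x ->
  (\forall p \near near2 A x, `|f p.1 - f p.2| <= k * `|p.1 - p.2|) ->
  blip A x f.
Proof.
move=> k0 Ax klip.
have [e e0 ek] :=
  (near2P A x (fun p => `|f p.1 - f p.2| <= k * `|p.1 - p.2|)).1 klip.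
(* The first two terms bound [f] on the ball of radius [e] by comparison with [f x]; the last makes
   the same constant dominate the Lipschitz constant. *)
exists (k * e + `|f x| + k).
  by rewrite !addr_ge0 ?mulr_ge0 ?normr_ge0// ltW.
apply: (near2P A x _).2; exists e => // y z Ay Az xy xz.
have bnd w : A w -> `|x - w| < e -> `|f w| <= k * e + `|f x| + k.
  move=> Aw xw; have := ek x w Ax Aw; rewrite subrr normr0 => /(_ e0 xw) fw.
  rewrite -[f w](subKr (f x)) (le_trans (ler_normB _ _))//.
  rewrite addrAC addrC lerD// ler_wpDr ?k0// (le_trans fw)//.
  by rewrite ler_wpM2l// ltW.
split; [exact: bnd|exact: bnd|].
apply: le_trans (ek y z Ay Az xy xz) _; rewrite ler_wpM2r// lerDr.
by rewrite addr_ge0 ?mulr_ge0 ?(ltW e0).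
Qed.

Lemma locally_lipschitz_blip (R : realType) (T W : normedModType R)
    (A : set T) (f : T -> W) (x : T) :
  locally_lipschitz A f -> A x -> blip A x f.
Proof.
move=> fA Ax; have fx : lipschitz_on f (near2 A x) := fA (x, x) (conj Ax Ax).
have [k k0 klip] := pinfty_ex_gt0 fx.
exact: blip_near (ltW k0) Ax klip.
Qed.

(** At a pair of distinct points [x] and [y], boundedness suffices: nearby [v] and [w] stay at
    distance at least a third of that between [x] and [y]. *)
Lemma blip_locally_lipschitz (R : realType) (T W : normedModType R)
    (A : set T) (f : T -> W) :
  (forall x, A x -> blip A x f) -> locally_lipschitz A f.
Proof.
move=> fA [x y] [/= Ax Ay].
have [->|xy] := eqVneq x y.
  have [k k0 kf] := fA y Ay; rewrite /lipschitz_on.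
  exists k; split => [|M kM]; first by rewrite num_real.
  apply: filterS kf => p [_ _ h]; apply: le_trans h _.
  by rewrite ler_wpM2r// ltW.
have [k k0 kf] := fA x Ax; have [d d0 df] := (near2P A x _).1 kf.
have [l l0 lf] := fA y Ay; have [e e0 ef] := (near2P A y _).1 lf.
have r0 : 0 < `|x - y| by rewrite normr_gt0 subr_eq0.
exists ((k + l) / (`|x - y| / 3)); split => [|M kM]; first by rewrite num_real.
apply/nbhs_ballP; exists (Num.min (Num.min d e) (`|x - y| / 3)) => /=.
  by rewrite !lt_min d0 e0 divr_gt0.
move=> [v w] /= []; rewrite -!ball_normE/= !lt_min => /andP[/andP[xvd _] xvr].
move=> /andP[/andP[_ ywe] ywr] [/= Av Aw].
have [fv _ _] := df v v Av Av xvd xvd; have [fw _ _] := ef w w Aw Aw ywe ywe.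
have vw : `|x - y| / 3 <= `|v - w|.
  have : `|x - y| <= `|x - v| + `|v - w| + `|y - w|.
    rewrite -[leLHS](_ : `|(x - v) + (v - w) - (y - w)| = _); last first.
      by congr (`|_|); rewrite addrA subrK opprB addrA subrK.
    by rewrite (le_trans (ler_normB _ _))// lerD2r ler_normD.
  lra.
apply: le_trans (_ : k + l <= _).
  by rewrite (le_trans (ler_normB _ _))// lerD.
have M0 : 0 <= M.
  by apply: le_trans (ltW kM); rewrite !mulr_ge0 ?invr_ge0 ?mulr_ge0 ?addr_ge0.
apply: le_trans (_ : M * (`|x - y| / 3) <= _); last by rewrite ler_wpM2l.
by rewrite -ler_pdivrMr ?divr_gt0// ltW.
Qed.

Lemma ler_coord_mx_norm (R : realType) m n (M : 'M[R]_(m, n)) i j :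
  `|M i j| <= `|M|.
Proof.
by rewrite [leRHS]mx_normrE (le_bigmax _ (fun ij => `|M ij.1 ij.2|) (i, j)).
Qed.

(** * Closure under algebraic operations, inversion and composition *)

Section blip_closure.
Variables (R : realType) (T : normedModType R) (A : set T) (x : T).
Implicit Types W : normedModType R.

Lemma blip_eq W (f f' : T -> W) :
  (forall y, A y -> f y = f' y) -> blip A x f -> blip A x f'.
Proof.
move=> ff' [k k0 kf]; exists k => //.
near=> p; have [Ap1 Ap2] : A p.1 /\ A p.2 by near: p; exact: near2_in.
by rewrite /blip_pair -!ff'//; near: p.
Unshelve. all: by end_near. Qed.

Lemma blip_cst W (w : W) : blip A x (fun=> w).
Proof.
exists `|w| => //; apply: filterE => p; split => //.
by rewrite subrr normr0 mulr_ge0.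
Qed.

Lemma blipD W (f f' : T -> W) :
  blip A x f -> blip A x f' -> blip A x (fun y => f y + f' y).
Proof.
move=> [k k0 kf] [l l0 lf]; exists (k + l); first by rewrite addr_ge0.
near=> p.
have [f1 f2 f12] : blip_pair f k p by near: p.
have [g1 g2 g12] : blip_pair f' l p by near: p.
split; try by rewrite (le_trans (ler_normD _ _))// lerD.
by rewrite opprD addrACA (le_trans (ler_normD _ _))// mulrDl lerD.
Unshelve. all: by end_near. Qed.

Lemma blipZ W (a : T -> R) (f : T -> W) :
  blip A x a -> blip A x f -> blip A x (fun y => a y *: f y).
Proof.
move=> [k k0 ka] [l l0 lf]; exists (k * l + k * l).
  by rewrite addr_ge0 ?mulr_ge0.
near=> p.
have [a1 a2 a12] : blip_pair a k p by near: p.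
have [f1 f2 f12] : blip_pair f l p by near: p.
have kl : k * l <= k * l + k * l by rewrite lerDl mulr_ge0.
split; rewrite ?normrZ; try by rewrite (le_trans _ kl)// ler_pM.
have -> : a p.1 *: f p.1 - a p.2 *: f p.2 =
    a p.1 *: (f p.1 - f p.2) + (a p.1 - a p.2) *: f p.2.
  by rewrite scalerBr scalerBl addrA subrK.
rewrite (le_trans (ler_normD _ _))// !normrZ mulrDl lerD//.
  by rewrite -mulrA ler_pM.
by rewrite mulrAC ler_pM.
Unshelve. all: by end_near. Qed.

Lemma blipM (f f' : T -> R) :
  blip A x f -> blip A x f' -> blip A x (fun y => f y * f' y).
Proof. exact: (@blipZ R^o). Qed.

Lemma blipN W (f : T -> W) : blip A x f -> blip A x (fun y => - f y).
Proof.
move=> fA; apply: blip_eq (blipZ (blip_cst (-1 : R)) fA) => y _.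
by rewrite scaleN1r.
Qed.

Lemma blipB W (f f' : T -> W) :
  blip A x f -> blip A x f' -> blip A x (fun y => f y - f' y).
Proof. by move=> fA f'A; apply: blipD fA (blipN f'A). Qed.

Lemma blip_sum W (I : Type) (r : seq I) (P : pred I) (f : I -> T -> W) :
  (forall i, blip A x (f i)) -> blip A x (fun y => \sum_(i <- r | P i) f i y).
Proof.
move=> fA; elim: r => [|i r IH].
  apply: (@blip_eq _ (fun=> 0)) => [y _|]; last exact: blip_cst.
  by rewrite big_nil.
have [Pi|nPi] := boolP (P i).
  by apply: blip_eq (blipD (fA i) IH) => y _; rewrite big_cons Pi.
by apply: blip_eq IH => y _; rewrite big_cons (negbTE nPi).
Qed.

Lemma blip_prod (I : Type) (r : seq I) (P : pred I) (f : I -> T -> R) :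
  (forall i, blip A x (f i)) -> blip A x (fun y => \prod_(i <- r | P i) f i y).
Proof.
move=> fA; elim: r => [|i r IH].
  apply: (@blip_eq R^o (fun=> 1)) => [y _|]; last exact: blip_cst.
  by rewrite big_nil.
have [Pi|nPi] := boolP (P i).
  by apply: blip_eq (blipM (fA i) IH) => y _; rewrite big_cons Pi.
by apply: blip_eq IH => y _; rewrite big_cons (negbTE nPi).
Qed.

Lemma blip_coord m n (M : T -> 'M[R]_(m, n)) i j :
  blip A x M -> blip A x (fun y => M y i j).
Proof.
move=> [k k0 kM]; exists k => //; near=> p.
have [M1 M2 M12] : blip_pair M k p by near: p.
split; rewrite ?(le_trans (ler_coord_mx_norm _ _ _))//; apply: le_trans M12.
by have := ler_coord_mx_norm (M p.1 - M p.2) i j; rewrite !mxE.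
Unshelve. all: by end_near. Qed.

(** Expansion in elementary matrices reduces a matrix to finite sums of scaled constants. *)
Lemma blip_mx m n (M : T -> 'M[R]_(m, n)) :
  (forall i j, blip A x (fun y => M y i j)) -> blip A x M.
Proof.
move=> MA; apply: (@blip_eq _ (fun y => \sum_i \sum_j M y i j *: delta_mx i j)).
  by move=> y _; rewrite -matrix_sum_delta.
by do 2 apply: blip_sum => ?; apply: blipZ => //; exact: blip_cst.
Qed.

Lemma blip_mulmx m n p (M : T -> 'M[R]_(m, n)) (N : T -> 'M[R]_(n, p)) :
  blip A x M -> blip A x N -> blip A x (fun y => M y *m N y).
Proof.
move=> MA NA; apply: blip_mx => i j.
apply: (@blip_eq _ (fun y => \sum_k M y i k * N y k j)).
  by move=> y _; rewrite mxE.
by apply: blip_sum => k; apply: blipM; exact: blip_coord.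
Qed.

Lemma blip_trmx m n (M : T -> 'M[R]_(m, n)) :
  blip A x M -> blip A x (fun y => (M y)^T).
Proof.
move=> MA; apply: blip_mx => i j.
by apply: blip_eq (blip_coord j i MA) => y _; rewrite mxE.
Qed.

Lemma blip_row_mx m n1 n2 (M : T -> 'M[R]_(m, n1)) (N : T -> 'M[R]_(m, n2)) :
  blip A x M -> blip A x N -> blip A x (fun y => row_mx (M y) (N y)).
Proof.
move=> MA NA; apply: blip_mx => i j; have [j'|j'] := split_ordP j => ->.
  by apply: blip_eq (blip_coord i j' MA) => y _; rewrite row_mxEl.
by apply: blip_eq (blip_coord i j' NA) => y _; rewrite row_mxEr.
Qed.

Lemma blip_det n (M : T -> 'M[R]_n) :
  (forall i j, blip A x (fun y => M y i j)) -> blip A x (fun y => \det (M y)).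
Proof.
(* [\det] unfolds to the Leibniz sum, whose signs are constants. *)
move=> MA; apply: blip_sum => s; apply: blipM; first exact: blip_cst.
by apply: blip_prod => i.
Qed.

Lemma blip_adj n (M : T -> 'M[R]_n) :
  blip A x M -> blip A x (fun y => \adj (M y)).
Proof.
move=> MA; apply: blip_mx => i j.
apply: (@blip_eq _ (fun y => cofactor (M y) j i)) => [y _|].
  by rewrite mxE.
apply: blipM; first exact: blip_cst.
apply: blip_det => i' j'.
by apply: blip_eq (blip_coord (lift j i') (lift i j') MA) => y _; rewrite !mxE.
Qed.

Lemma blip_lower (f : T -> R) : A x -> blip A x f -> 0 < f x ->
  exists2 c, 0 < c & \forall p \near near2 A x, c <= f p.1 /\ c <= f p.2.
Proof.
move=> Ax [k k0 kf] fx0.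
have [d d0 df] := (near2P A x _).1 kf.
exists (f x / 2); first by rewrite divr_gt0.
apply: (near2P A x (fun p => f x / 2 <= f p.1 /\ f x / 2 <= f p.2)).2.
have k1 : 0 < k + 1 by rewrite ltr_wpDl.
(* Within this radius [f] varies by less than [f x / 2]; [k + 1] replaces [k] because [k] may be
   0. *)
exists (Num.min d (f x / 2 / (k + 1))).
  by rewrite lt_min d0 !divr_gt0.
have low v : A v -> `|x - v| < Num.min d (f x / 2 / (k + 1)) -> f x / 2 <= f v.
  move=> Av; rewrite lt_min => /andP[xvd].
  rewrite ltr_pdivlMr// => xvk.
  have [||_ _ xv] := df x v Ax Av => //; first by rewrite subrr normr0.
  have : f x - f v <= `|f x - f v| by exact: ler_norm.
  have := normr_ge0 (x - v); nra.
by move=> v w Av Aw xv xw; split; apply: low.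
Qed.

(** The inverse of [f] is [f] times the inverse of its square, and the square is positive at [x]
    whatever the sign of [f x], so [blip_lower] applies. *)
Lemma blip_inv (f : T -> R) : A x -> blip A x f -> f x != 0 ->
  blip A x (fun y => (f y)^-1).
Proof.
move=> Ax fA fx0; have ffA := blipM fA fA.
have ff0 : 0 < f x * f x by rewrite -expr2 exprn_even_gt0.
suff invA : blip A x (fun y => (f y * f y)^-1).
  apply: blip_eq (blipM fA invA) => y _.
  (* The identity is required on all of [A], where [f] may vanish away from [x]; it then holds
     because the inverse of 0 is 0. *)
  have [->|fy0] := eqVneq (f y) 0; first by rewrite invr0 mul0r.
  by rewrite invfM mulrA divff// mul1r.
have [c c0 cf] := blip_lower Ax ffA ff0.
move: ffA cf; set F := fun y => f y * f y => -[k k0 kF] cF.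
(* The first term bounds the inverse, the second is its Lipschitz constant. *)
exists (c^-1 + k / c ^+ 2).
  by rewrite addr_ge0 ?divr_ge0 ?invr_ge0 ?exprn_ge0// ltW.
near=> p.
have [F1 F2 F12] : blip_pair F k p by near: p.
have [c1 c2] : c <= F p.1 /\ c <= F p.2 by near: p.
have inv_le z : c <= z -> `|z^-1| <= c^-1.
  move=> cz; have z0 : 0 < z by apply: lt_le_trans cz.
  by rewrite gtr0_norm ?invr_gt0// lef_pV2.
have le_k : c^-1 <= c^-1 + k / c ^+ 2.
  by rewrite lerDl divr_ge0// exprn_ge0// ltW.
split; try by rewrite (le_trans _ le_k)// inv_le.
have F1n : F p.1 != 0 by rewrite gt_eqF// (lt_le_trans c0).
have F2n : F p.2 != 0 by rewrite gt_eqF// (lt_le_trans c0).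
rewrite -!/(F _) (_ : _ - _ = (F p.2 - F p.1) * ((F p.1)^-1 * (F p.2)^-1)).
  rewrite !normrM distrC mulrDl ler_wpDl ?mulr_ge0 ?invr_ge0 ?(ltW c0)//.
  rewrite mulrAC; apply: ler_pM => //.
  by rewrite -exprVn expr2; apply: ler_pM => //; exact: inv_le.
move: (F p.1) (F p.2) F1n F2n => u v u0 v0; by field; rewrite ?u0 ?v0.
Unshelve. all: by end_near. Qed.

Lemma blip_invmx n (M : T -> 'M[R]_n) : A x -> blip A x M ->
  (forall y, A y -> M y \in unitmx) -> blip A x (fun y => invmx (M y)).
Proof.
move=> Ax MA Mu.
apply: (@blip_eq _ (fun y => (\det (M y))^-1 *: \adj (M y))).
  by move=> y Ay; rewrite /invmx Mu.
apply: blipZ; last exact: blip_adj.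
apply: blip_inv => //; first by apply: blip_det => i j; exact: blip_coord.
by have := Mu x Ax; rewrite unitmxE unitfE.
Qed.

End blip_closure.

(** Meant for [alpha \o h]: the outer function is controlled on a set [A'] of reals only, which must
    contain the values of [f] on [A]. *)
Lemma blip_comp (R : realType) (T : normedModType R) (A : set T) (A' : set R)
    (x : T) (f : T -> R) (g : R -> R) :
  A x -> (forall y, A y -> A' (f y)) -> blip A x f -> blip A' (f x) g ->
  blip A x (g \o f).
Proof.
move=> Ax AA' [k k0 kf] [l l0 lg].
have [d d0 df] := (near2P A x _).1 kf.
have [e e0 eg] := (@near2P R R^o A' (f x) _).1 lg.
exists (l + l * k); first by rewrite addr_ge0 ?mulr_ge0.
apply: (near2P A x _).2.
have k1 : 0 < k + 1 by rewrite ltr_wpDl.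
exists (Num.min d (e / (k + 1))); first by rewrite lt_min d0 divr_gt0.
have fe v : A v -> `|x - v| < Num.min d (e / (k + 1)) -> `|f x - f v| < e.
  move=> Av; rewrite lt_min => /andP[xvd]; rewrite ltr_pdivlMr// => xvk.
  have [||_ _ xv] := df x v Ax Av => //; first by rewrite subrr normr0.
  have := normr_ge0 (x - v); nra.
move=> v w Av Aw xv xw.
have [||g1 g2 g12] := eg (f v) (f w) (AA' _ Av) (AA' _ Aw); try exact: fe.
move: xv xw; rewrite !lt_min => /andP[xv _] /andP[xw _].
have [_ _ f12] := df v w Av Aw xv xw.
have lk : l <= l + l * k by rewrite lerDl mulr_ge0.
split => /=; try by rewrite (le_trans _ lk).
rewrite (le_trans g12)// mulrDl ler_wpDl ?mulr_ge0//.
by rewrite -mulrA ler_wpM2l.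
Qed.

(** * Gradients and the mean value theorem *)

Lemma derive_gradient (R : realType) (n : nat) (W : 'cV[R]_n -> R)
    (p v : 'cV[R]_n) :
  differentiable W p -> 'D_v W p = (gradient W p *m v) 0 0.
Proof.
move=> dW; rewrite deriveE// [v in LHS]matrix_sum_delta linear_sum mxE.
apply: eq_bigr => j _; rewrite big_ord1 linearZ mxE deriveE//= mulrC.
by [].
Qed.

Lemma mulmx_row_col_le (R : realType) (n : nat) (u : 'rV[R]_n) (v : 'cV[R]_n) :
  `|(u *m v) 0 0| <= n%:R * `|u| * `|v|.
Proof.
rewrite mxE (le_trans (ler_norm_sum _ _ _))//.
apply: le_trans (_ : \sum_(i < n) `|u| * `|v| <= _).
  by apply: ler_sum => i _; rewrite normrM ler_pM// ler_coord_mx_norm.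
by rewrite sumr_const card_ord -mulrA mulr_natl.
Qed.

(** The difference quotient of the restriction to the line at [t] is the one defining the
    directional derivative at [z + t *: v]. *)
Lemma derivable_line (R : realType) (n : nat) (W : 'cV[R]_n -> R)
    (z v : 'cV[R]_n) (t : R) :
  differentiable W (z + t *: v) ->
  is_derive t 1 (fun s : R => W (z + s *: v)) ('D_v W (z + t *: v)).
Proof.
move=> dW.
pose phi (s : R) : R := W (z + s *: v).
have E : (fun h : R => h^-1 *: ((phi \o shift t) (h *: 1) - phi t)) =
    (fun h : R => h^-1 *: ((W \o shift (z + t *: v)) (h *: v) - W (z + t *: v))).
  apply/funext => h /=; congr (_ *: (W _ - _)).
  by rewrite [h *: 1]mulr1 scalerDl addrCA.
apply: DeriveDef; last by rewrite /derive E.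
rewrite /derivable E; exact: diff_derivable.
Qed.

(** Mean value theorem on segments of a ball around [x] where the gradient is bounded. Such segments
    may leave [A], so differentiability is asked on a full neighbourhood of [x]. *)
Lemma C1_blip (R : realType) (n : nat) (W : 'cV[R]_n -> R) (x : 'cV[R]_n)
    (A : set 'cV[R]_n) :
  A x ->
  (\forall y \near x, differentiable W y /\ {for y, continuous (gradient W)}) ->
  blip A x W.
Proof.
move=> Ax WC; have [_ gx] := nbhs_singleton WC.
pose K := `|gradient W x| + 1.
have gK : \forall y \near x, `|gradient W y| < K.
  by apply: cvgr_norm_lt gx _ _; rewrite ltrDl.
have : \forall y \near x, differentiable W y /\ `|gradient W y| < K.
  near=> y; split; last by near: y.
  by have [] : differentiable W y /\ {for y, continuous (gradient W)} by near: y.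
move=> /nbhs_ballP[e /= e0 eW].
have K0 : 0 <= K by rewrite addr_ge0.
(* The factor [n] comes from bounding a row times a column by max norms. *)
apply: (@blip_near _ _ _ _ _ _ (n%:R * K)) => //; first by rewrite mulr_ge0.
apply: (near2P A x _).2.
exists e => // y z _ _ xy xz.
have segW (t : R) : 0 <= t <= 1 -> differentiable W (z + t *: (y - z)) /\
    `|gradient W (z + t *: (y - z))| < K.
  move=> /andP[t0 t1]; apply: eW; rewrite -ball_normE /=.
  have -> : x - (z + t *: (y - z)) = t *: (x - y) + (1 - t) *: (x - z).
    by apply/matrixP => i j; rewrite !mxE; ring.
  rewrite (le_lt_trans (ler_normD _ _))// !normrZ !ger0_norm ?subr_ge0//.
  have [->|t_neq1] := eqVneq t 1; first by rewrite subrr mul0r addr0 mul1r.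
  have t1' : 0 < 1 - t by rewrite subr_gt0 lt_neqAle t_neq1.
  nra.
have is_der (t : R) : 0 <= t <= 1 ->
    is_derive t 1 (fun s : R => W (z + s *: (y - z))) ('D_(y - z) W (z + t *: (y - z))).
  by move=> /segW[dW _]; exact: derivable_line.
have [||t] := @MVT_segment R (fun s => W (z + s *: (y - z)))
  (fun t => 'D_(y - z) W (z + t *: (y - z))) 0 1 ler01.
- by move=> t; rewrite in_itv /= => /andP[t0 t1]; apply: is_der; rewrite !ltW.
- apply: derivable_within_continuous => t; rewrite in_itv /= => t01.
  exact: (@ex_derive _ _ _ _ _ _ _ (is_der t t01)).
rewrite in_itv /= => /segW[dW gW].
rewrite scale1r scale0r addr0 subr0 mulr1 (addrC z) subrK => ->.
rewrite derive_gradient// (le_trans (mulmx_row_col_le _ _))//.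
by rewrite ler_wpM2r// ler_wpM2l// ltW.
Unshelve. all: by end_near. Qed.

(** * Lipschitz dependence of the multipliers and of the minimizer *)

(** Two passes: the perturbation in [lcp2_stable] involves the multipliers of the second problem, so
    [lcp2_bound] first bounds all multipliers near [x]. Near [x] the determinant stays above a
    constant [c > 0]. *)
Lemma blip_lcp2 (R : realType) (T : normedModType R) (A : set T) (x : T)
    (G11 G12 G22 q1 q2 l1 l2 : T -> R) : A x ->
  blip A x G11 -> blip A x G12 -> blip A x G22 -> blip A x q1 -> blip A x q2 ->
  (forall y, A y -> 0 < G11 y + G22 y) ->
  (forall y, A y -> 0 < G11 y * G22 y - G12 y ^+ 2) ->
  (forall y, A y -> lcp2 (G11 y) (G12 y) (G22 y) (q1 y) (q2 y) (l1 y) (l2 y)) ->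
  blip A x l1 /\ blip A x l2.
Proof.
move=> Ax b11 b12 b22 bq1 bq2 tr_gt0 det_gt0 l_lcp.
have bdet : blip A x (fun y => G11 y * G22 y - G12 y ^+ 2).
  by apply: blipB; apply: blipM.
have [c c0 cdet] := blip_lower Ax bdet (det_gt0 x Ax).
move: b11 b12 b22 bq1 bq2 => [a a0 ba] [b b0 bb] [d d0 bd] [e e0 be] [f f0 bf].
(* [K] bounds twice the trace and [M] the multipliers. *)
pose K := (a + d) * 2; pose M := K * (e + f) / c.
have K0 : 0 <= K by rewrite mulr_ge0 ?addr_ge0.
have M0 : 0 <= M by rewrite divr_ge0 ?mulr_ge0 ?addr_ge0 // ltW.
(* The factor [e + f + (a + b + d) * M] bounds the perturbation of the data per unit of distance. *)
pose N := M + K * (e + f + (a + b + d) * M) / c.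
have S0 : 0 <= e + f + (a + b + d) * M.
  by do ![apply: addr_ge0 => // | apply: mulr_ge0 => //].
have MN : M <= N by rewrite lerDl; apply: divr_ge0 (mulr_ge0 K0 S0) (ltW c0).
have N0 : 0 <= N by exact: le_trans MN.
suff H : \forall p \near near2 A x,
    [/\ `|l1 p.1| + `|l2 p.1| <= N, `|l1 p.2| + `|l2 p.2| <= N &
     `|l1 p.1 - l1 p.2| + `|l2 p.1 - l2 p.2| <= N * `|p.1 - p.2|].
  have le1 (u v w : R) : `|u| + `|v| <= w -> `|u| <= w.
    by apply: le_trans; rewrite lerDl.
  have le2 (u v w : R) : `|u| + `|v| <= w -> `|v| <= w.
    by apply: le_trans; rewrite lerDr.
  by split; exists N => //; apply: filterS H => p [h1 h2 h3];
    split; solve [exact: le1 h1|exact: le1 h2|exact: le1 h3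
                 |exact: le2 h1|exact: le2 h2|exact: le2 h3].
near=> p.
have [Ap1 Ap2] : A p.1 /\ A p.2 by near: p; exact: near2_in.
have [c1 c2] : c <= G11 p.1 * G22 p.1 - G12 p.1 ^+ 2 /\
  c <= G11 p.2 * G22 p.2 - G12 p.2 ^+ 2 by near: p.
have [a1 a2 a12] : blip_pair G11 a p by near: p.
have [b1 b2 b12] : blip_pair G12 b p by near: p.
have [d1 d2 d12] : blip_pair G22 d p by near: p.
have [e1 e2 e12] : blip_pair q1 e p by near: p.
have [f1 f2 f12] : blip_pair q2 f p by near: p.
have div_c (D t s E : R) : 0 <= s -> 0 <= E -> c <= D -> t <= a + d ->
    D * s <= 2 * t * E -> s <= K * E / c.
  move=> s0 E0 cD tK DsE; rewrite ler_pdivlMr// mulrC.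
  apply: le_trans (_ : D * s <= _); first by rewrite ler_wpM2r.
  by rewrite (le_trans DsE)// ler_wpM2r// mulrC ler_wpM2r.
have tr_le y : `|G11 y| <= a -> `|G22 y| <= d -> G11 y + G22 y <= a + d.
  by move=> ya yd; rewrite lerD// (le_trans (ler_norm _)).
have ef : e <= e + f /\ f <= e + f by rewrite lerDl lerDr.
have bnd y : A y -> `|G11 y| <= a -> `|G22 y| <= d ->
    c <= G11 y * G22 y - G12 y ^+ 2 -> `|q1 y| <= e -> `|q2 y| <= f ->
    `|l1 y| + `|l2 y| <= M.
  move=> Ay ya yd yc ye yf; apply: div_c (tr_le _ ya yd) _; try exact: yc.
  - by rewrite addr_ge0.
  - by rewrite addr_ge0.
  - apply: lcp2_bound (tr_gt0 _ Ay) (det_gt0 _ Ay) (l_lcp _ Ay) _ _.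
      by rewrite (le_trans ye) ?ef.1.
    by rewrite (le_trans yf) ?ef.2.
have m1 := bnd _ Ap1 a1 d1 c1 e1 f1; have m2 := bnd _ Ap2 a2 d2 c2 e2 f2.
split; [exact: le_trans MN|exact: le_trans MN|].
set r := `|p.1 - p.2|; have r0 : 0 <= r := normr_ge0 _.
have l1M : `|l1 p.2| <= M by rewrite (le_trans _ m2)// lerDl.
have l2M : `|l2 p.2| <= M by rewrite (le_trans _ m2)// lerDr.
have : `|l1 p.1 - l1 p.2| + `|l2 p.1 - l2 p.2| <=
    K * ((e + f + (a + b + d) * M) * r) / c.
  apply: div_c (tr_le _ a1 d1) _; try exact: c1.
  - by rewrite addr_ge0.
  - by rewrite mulr_ge0.
  - have tri (u v w s t : R) : `|u - (v * s + w * t)| <=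
        `|u| + (`|v| * `|s| + `|w| * `|t|).
      by rewrite (le_trans (ler_normB _ _))// lerD2l -!normrM ler_normD.
    apply: lcp2_stable (tr_gt0 _ Ap1) (det_gt0 _ Ap1)
      (l_lcp _ Ap1) (l_lcp _ Ap2) _ _.
      apply: le_trans (tri _ _ _ _ _) _.
      apply: le_trans (_ : e * r + (a * r * M + b * r * M) <= _).
        by rewrite lerD// lerD// ler_pM.
      rewrite -subr_ge0 (_ : _ - _ = f * r + d * M * r); last by ring.
      by do ![apply: addr_ge0 => // | apply: mulr_ge0 => //].
    apply: le_trans (tri _ _ _ _ _) _.
    apply: le_trans (_ : f * r + (b * r * M + d * r * M) <= _).
      by rewrite lerD// lerD// ler_pM.
    rewrite -subr_ge0 (_ : _ - _ = e * r + a * M * r); last by ring.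
    by do ![apply: addr_ge0 => // | apply: mulr_ge0 => //].
move=> h; apply: le_trans h _; rewrite mulrA mulrAC ler_wpM2r// lerDr//.
Unshelve. all: by end_near. Qed.

Lemma blip_qp2_solution (R : realType) (T : normedModType R) (A : set T) (x : T)
    (k : nat) (H : T -> 'M[R]_k) (F : T -> 'cV[R]_k) (y1 y2 : T -> 'rV[R]_k)
    (p1 p2 : T -> R) :
  A x -> blip A x H -> blip A x F -> blip A x y1 -> blip A x y2 ->
  blip A x p1 -> blip A x p2 ->
  (forall y, A y -> [/\ posdefmx (H y), y1 y != 0, y2 y != 0 &
     0 < gram (H y) (y1 y) (y1 y) * gram (H y) (y2 y) (y2 y) -
         gram (H y) (y1 y) (y2 y) ^+ 2]) ->
  blip A x (fun y => qp2_solution (H y) (F y) (y1 y) (p1 y) (y2 y) (p2 y)).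
Proof.
move=> Ax HA FA y1A y2A p1A p2A nondeg.
have HVA : blip A x (fun y => invmx (H y)).
  by apply: blip_invmx => // y /nondeg[/posdefmx_unit].
have gramA (u v : T -> 'rV[R]_k) : blip A x u -> blip A x v ->
    blip A x (fun y => gram (H y) (u y) (v y)).
  move=> uA vA; apply: blip_coord; apply: blip_mulmx (blip_trmx vA).
  exact: blip_mulmx.
pose ubar y := - (invmx (H y) *m F y).
have ubarA : blip A x ubar by apply: blipN; exact: blip_mulmx.
have qA (u : T -> 'rV[R]_k) (p : T -> R) : blip A x u -> blip A x p ->
    blip A x (fun y => (u y *m ubar y) 0 0 - p y).
  by move=> uA; apply: blipB; apply: blip_coord; exact: blip_mulmx.
pose l y := lcp2_solution (gram (H y) (y1 y) (y1 y)) (gram (H y) (y1 y) (y2 y))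
  (gram (H y) (y2 y) (y2 y)) ((y1 y *m ubar y) 0 0 - p1 y)
  ((y2 y *m ubar y) 0 0 - p2 y).
(* The multipliers are treated as solutions of the complementarity problem, without opening their
   case distinction; the remaining operations in the closed form are algebraic. *)
have [l1A l2A] : blip A x (fun y => (l y).1) /\ blip A x (fun y => (l y).2).
  apply: (blip_lcp2 Ax (gramA _ _ y1A y1A) (gramA _ _ y1A y2A)
    (gramA _ _ y2A y2A) (qA _ _ y1A p1A) (qA _ _ y2A p2A)).
  - by move=> y /nondeg[Hy y1n y2n _]; rewrite addr_gt0 ?gram_gt0.
  - by move=> y /nondeg[].
  - by move=> y /nondeg[Hy y1n y2n det_gt0]; apply: lcp2_solutionP;
      rewrite ?gram_gt0.
apply: blipB => //; apply: blip_mulmx => //.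
by apply: blipD; apply: blipZ => //; exact: blip_trmx.
Qed.

(** * The quadratic program of the control system *)

Lemma mul_row_sub (R : realType) (m1 m2 : nat) (a : 'rV[R]_m1) (b : 'rV[R]_m2)
    (w : 'cV[R]_(m1 + m2)) :
  (row_mx a b *m w) 0 0 = (a *m usubmx w) 0 0 + (b *m dsubmx w) 0 0.
Proof. by rewrite -[w in LHS]vsubmxK mul_row_col mxE. Qed.

Theorem theorem3 (R : realType) (n1 n2 m : nat)
    (X : set 'cV[R]_n1) (Z : set 'cV[R]_n2) (U : set 'cV[R]_m)
    (f : 'cV[R]_(n1 + n2) -> 'cV[R]_(n1 + n2))
    (g : 'cV[R]_(n1 + n2) -> 'M[R]_(n1 + n2, m))
    (h B V : 'cV[R]_(n1 + n2) -> R)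
    (c3 : R) (a : \bar R) (alpha : R -> R)
    (H : 'cV[R]_(n1 + n2) -> 'M[R]_(m + 1))
    (F : 'cV[R]_(n1 + n2) -> 'cV[R]_(m + 1))
    (hsys : partitioned_system X Z f g)
    (hh : C1_on setT h)
    (hB : is_RCBF U f g h B)
    (hV : is_ESCLF U X Z f g V)
    (hc3 : 0 < c3)
    (halpha : classK a alpha)
    (halpha_dom : forall x, intC h x -> ((h x)%:E < a)%E)
    (hH : forall x, state_space X Z x -> posdefmx (H x))
    (f_lip : locally_lipschitz (state_space X Z) f)
    (g_lip : locally_lipschitz (state_space X Z) g)
    (gradB_lip : locally_lipschitz (intC h) (gradient B))
    (gradV_lip : locally_lipschitz (state_space X Z) (gradient V))
    (H_lip : locally_lipschitz (state_space X Z) H)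
    (F_lip : locally_lipschitz (state_space X Z) F)
    (alpha_lip :
      locally_lipschitz [set r : R | 0 < r /\ (r%:E < a)%E] alpha)
    (hdeg : forall x, intC h x -> lieG g B x != 0) :
  exists ustar : 'cV[R]_(n1 + n2) -> 'cV[R]_(m + 1),
    [/\ forall x, (intC h `&` state_space X Z) x ->
          forall v, is_argmin (clf_cbf_feasible f g h B V c3 alpha x)
                      (qp_cost (H x) (F x)) v <-> v = ustar x,
        locally_lipschitz (intC h `&` state_space X Z) ustar
      & forall x, (intC h `&` state_space X Z) x ->
          ustar x = clf_cbf_solution f g h B V c3 alpha H F x].
Proof.
pose y1 x : 'rV[R]_(m + 1) := row_mx (lieG g V x) (- 1%:M).
pose y2 x : 'rV[R]_(m + 1) := row_mx (lieG g B x) 0.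
have nondeg x : (intC h `&` state_space X Z) x ->
    [/\ posdefmx (H x), y1 x != 0, y2 x != 0 &
     0 < gram (H x) (y1 x) (y1 x) * gram (H x) (y2 x) (y2 x) -
         gram (H x) (y1 x) (y2 x) ^+ 2].
  move=> [/= hx /hH Hx].
  have y2_neq0 : y2 x != 0.
    apply: contra_neq (hdeg x hx) => /(congr1 lsubmx).
    by rewrite row_mxKl linear0.
  (* In the column of the relaxation variable, [y1 x] has entry -1 and [y2 x] has entry 0, so [r]
     can be read off there. *)
  have indep (r s : R) : r != 0 -> r *: y1 x - s *: y2 x != 0.
    move=> r_neq0; apply: contra_neq r_neq0 => /(congr1 rsubmx)/matrixP/(_ 0 0).
    rewrite !scale_row_mx opp_row_mx add_row_mx row_mxKr scaler0 oppr0 addr0.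
    by rewrite linear0 !mxE /= mulrN1 => /eqP; rewrite oppr_eq0 => /eqP.
  split=> //.
    by have := indep 1 0 (oner_neq0 _); rewrite scale1r scale0r subr0.
  apply: gram_det_gt0 => //; apply: indep.
  by rewrite gt_eqF ?gram_gt0.
exists (clf_cbf_solution f g h B V c3 alpha H F); split=> // [x Sx v|].
  have [Hx y1n y2n det_gt0] := nondeg x Sx.
  rewrite /clf_cbf_solution -qp2_solution_argmin//.
  rewrite (_ : clf_cbf_feasible _ _ _ _ _ _ _ _ = [set w |
    (y1 x *m w) 0 0 <= - lieF f V x - c3 * V x /\
    (y2 x *m w) 0 0 <= alpha (h x) - lieF f B x])//.
  apply/seteqP; split=> w; rewrite /clf_cbf_feasible /y1 /y2 /= !mul_row_sub;
    rewrite mul0mx mulNmx mul1mx !mxE => -[w1 w2]; split; lra.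
apply: blip_locally_lipschitz => x Sx; have [/= hx Xx] := Sx.
set S := intC h `&` _ in Sx *.
have restr (W : normedModType R) (A : set 'cV[R]_(n1 + n2))
    (k : 'cV[R]_(n1 + n2) -> W) :
    S `<=` A -> locally_lipschitz A k -> blip S x k.
  move=> SA kA; apply: (blip_subset SA).
  by apply: locally_lipschitz_blip kA _; exact: SA.
have SX : S `<=` state_space X Z by move=> y [].
have SC : S `<=` intC h by move=> y [].
have lieFA (W : 'cV[R]_(n1 + n2) -> R) : blip S x (gradient W) ->
    blip S x (lieF f W).
  by move=> WA; apply: blip_coord; apply: blip_mulmx WA (restr _ _ _ SX f_lip).
have lieGA (W : 'cV[R]_(n1 + n2) -> R) : blip S x (gradient W) ->
    blip S x (lieG g W).
  by move=> WA; apply: blip_mulmx WA (restr _ _ _ SX g_lip).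
have VA : blip S x V by apply: C1_blip => //; exact: hV.1.
(* On the interior [h] is positive, so [alpha] is evaluated strictly inside its interval, where it
   is Lipschitz. *)
have alphahA : blip S x (alpha \o h).
  apply: (blip_comp (A' := [set r : R | 0 < r /\ (r%:E < a)%E])) => //.
  - by move=> y [hy _]; split=> //; exact: halpha_dom.
  - by apply: C1_blip => //; exact: hh.
  - by apply: locally_lipschitz_blip alpha_lip _; split=> //; exact: halpha_dom.
have gVA := restr _ _ _ SX gradV_lip; have gBA := restr _ _ _ SC gradB_lip.
apply: blip_qp2_solution nondeg => //.
- exact: restr SX H_lip.
- exact: restr SX F_lip.
- by apply: blip_row_mx; [exact: lieGA|exact: blip_cst].
- by apply: blip_row_mx; [exact: lieGA|exact: blip_cst].
- apply: blipB; first by apply: blipN; exact: lieFA.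
  by apply: blipM => //; exact: blip_cst.
- by apply: blipB; [exact: alphahA|exact: lieFA].
Qed.
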